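(* Let $p$ be a prime, $n\ge2$, $F=\mathbb{F}_{p^n}$. Let $f\colon F\to F$ be a GAPN function with $d^\circ(f)=p$. Let $\mu$ assign to each $a\in F^\times$ an $\mathbb{F}_p$-linear automorphism $\mu_a$ of $F$, and let $\nu$ be a permutation of $F$ with $\nu(0)=0$. Suppose that $\tilde B_{f,\mu,\nu}$ is $\mathbb{F}_p$-bilinear. For $a\in F$ put $X(a)=\{(x,\tilde B_{f,\mu,\nu}(x,a)) : x\in F\}\subseteq F\oplus F$. Let $M\subseteq F$ be a set such that no three mutually different elements of $M$ lie on the same line. Then the collection $\{X(a): a\in M\}$ is an $(n-1)$-dimensional dual arc over $\mathbb{F}_p$ in $F\oplus F$ (regarded as an $\mathbb{F}_p$-vector space).
   Context: For $a,x\in F$ put $\tilde{D}_a f(x)=\sum_{j\in\mathbb{F}_p} f(x+ja)$, $\tilde N_f(a,b)=\#\{x\in F:\tilde D_af(x)=b\}$; $f$ is GAPN if $\tilde N_f(a,b)\le p$ for all $a\in F^\times$, $b\in F$. For $m\ge1$, $[f]^m(x_1,\dots,x_m)=\sum_{I\subseteq\{1,\dots,m\}}(-1)^{m-|I|}f\big(\sum_{k\in I}x_k\big)$, $[f]^0=f(0)$; for nonzero $f$, $d^\circ(f)$ is the largest $m\ge0$ with $[f]^m\not\equiv0$. Set $\tilde B_f(x,y)=[f]^p(x,y,\dots,y)$ ($y$ repeated $p-1$ times), and $\tilde B_{f,\mu,\nu}(x,a)=\mu_a(\tilde B_f(x,\nu(a)))$ for $a\ne0$, $\tilde B_{f,\mu,\nu}(x,0)=0$.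 Elements of $F$ lie on the same line if they belong to a set $\{u+tv:t\in\mathbb{F}_p\}$ with $u,v\in F$, $v\neq0$. A collection $\mathcal S$ of $m$-dimensional subspaces of an $\mathbb{F}_q$-vector space is an $(m-1)$-dimensional dual arc over $\mathbb{F}_q$ if $\dim(X\cap Y)=1$ for any different $X,Y\in\mathcal S$ and $X\cap Y\cap Z=0$ for any three mutually different $X,Y,Z\in\mathcal S$. *)

(* Defs.v *)
From HB Require Import structures.
From mathcomp Require Import all_boot all_order all_algebra all_field.

Set Implicit Arguments.
Unset Strict Implicit.
Unset Printing Implicit Defensive.

Import GRing.Theory.
Local Open Scope ring_scope.

(* F is a field extension of 'F_p, so that its 'F_p-vector space structure is
   the canonical one; [finvect_type F] is F itself with its finType structure,
   used for sets and cardinals. *)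
Section GAPN.

Variables (p : nat) (F : fieldExtType 'F_p).
Implicit Types (f : F -> F) (a b x y u v : F).

Definition Dtilde f a x : F := \sum_(j : 'F_p) f (x + j *: a).

Definition Ntilde f a b : nat :=
  #|[set x : finvect_type F | Dtilde f a x == b]|.

Definition GAPN f : Prop := forall a b, a != 0 -> (Ntilde f a b <= p)%N.

(* [f]^m; for m = 0 this is the single term f 0. *)
Definition mdiff f m (x : 'I_m -> F) : F :=
  \sum_(I : {set 'I_m}) (-1) ^+ (m - #|I|) * f (\sum_(k in I) x k).

(* d°(f) = d, as a relation; the first clause forces f to be nonzero. *)
Definition alg_degree f (d : nat) : Prop :=
  (exists x : 'I_d -> F, mdiff f x != 0) /\
  (forall m (x : 'I_m -> F), (d < m)%N -> mdiff f x = 0).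

Definition Btilde f x y : F :=
  mdiff f (fun i : 'I_p => if i == 0%N :> nat then x else y).

Definition Btilde_twist f (mu : F -> 'End(F)) (nu : F -> F) x a : F :=
  if a == 0 then 0 else mu a (Btilde f x (nu a)).

Definition line u v : {set finvect_type F} :=
  [set (u + t *: v : finvect_type F) | t : 'F_p].

Definition on_same_line (A : {set finvect_type F}) : Prop :=
  exists u v, v != 0 /\ A \subset line u v.

Definition graph_set (B : F -> F -> F) a : {set finvect_type (F * F)%type} :=
  [set ((x, B x a) : finvect_type (F * F)%type) | x : finvect_type F].

End GAPN.

Section DualArc.

Variables (K : finFieldType) (V : vectType K).
Implicit Types X Y Z : {set finvect_type V}.

Definition subspace_of_dim (m : nat) X : Prop :=
  exists U : {vspace V}, X = [set v : finvect_type V | (v : V) \in U] /\ \dim U = m.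

(* A d-dimensional dual arc consists of (d + 1)-dimensional subspaces. *)
Definition dual_arc (d : nat) (S : {set {set finvect_type V}}) : Prop :=
  [/\ forall X, X \in S -> subspace_of_dim d.+1 X,
      forall X Y, X \in S -> Y \in S -> X != Y -> subspace_of_dim 1 (X :&: Y)
    & forall X Y Z, X \in S -> Y \in S -> Z \in S ->
        X != Y -> Y != Z -> X != Z -> X :&: Y :&: Z = [set 0]].

End DualArc.

(* Main.v *)
(** Modulo [p] the binomials [C(p-1, k)] are [(-1)^k], so expanding [[f]^p]
    gives [Btilde f x a = Dtilde f a x - Dtilde f a 0].  This vanishes on the
    line spanned by [a], and at no more than [p] points because [f] is GAPN:
    for [a != 0] the kernel of [Btilde f ^~ a] is that line.  Hence [X(a)] and
    [X(b)] meet above the line spanned by [nu (a - b)].  If a third [X(c)]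
    contains a common nonzero point above [x], then [a - b] and [c - b] both lie
    in the kernel of the twisted form at [x], which is again a line; so [a], [b]
    and [c] would be collinear. *)
Require Import Defs.
From HB Require Import structures.
From mathcomp Require Import all_boot all_order all_algebra all_field.

Import GRing.Theory.
Local Open Scope ring_scope.

(** Subsets are sorted by whether they contain [ord0], the one index that carries [x] in [Btilde];
    this pairs [f (x + y *+ k)] with [f (y *+ k)]. *)
Lemma big_set_ordS (R : Type) (idx : R) (op : Monoid.com_law idx) q
    (G : {set 'I_q.+1} -> R) :
  \big[op/idx]_(I : {set 'I_q.+1}) G I =
  \big[op/idx]_(J : {set 'I_q})
     op (G (ord0 |: lift ord0 @: J)) (G (lift ord0 @: J)).
Proof.
have liftI := @lift_inj _ (@ord0 q).
have ord0N (J : {set 'I_q}) : ord0 \notin lift ord0 @: J.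
  by apply/imsetP => -[j _ /eqP]; rewrite (negbTE (neq_lift _ _)).
have preK (J : {set 'I_q}) : lift ord0 @^-1: (lift ord0 @: J) = J.
  by apply/setP => j; rewrite inE (mem_imset _ _ liftI).
have imK (I : {set 'I_q.+1}) :
    lift ord0 @: (lift ord0 @^-1: I) = I :\ ord0.
  apply/setP => i; rewrite !inE; case: (unliftP ord0 i) => [j|] ->.
    by rewrite (mem_imset _ _ liftI) inE eq_sym neq_lift.
  by rewrite eqxx (negbTE (ord0N _)).
rewrite big_split (bigID (fun I : {set 'I_q.+1} => ord0 \in I)) /=.
congr (op _ _).
  rewrite (reindex_onto (fun J : {set 'I_q} => ord0 |: lift ord0 @: J)
    (fun I => lift ord0 @^-1: I)) /= => [|I I0]; last by rewrite imK setD1K.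
  apply: eq_bigl => J; rewrite setU11 -[RHS](eqxx J) /=.
  congr (_ == _); apply/setP => j.
  by rewrite !inE eq_sym (negbTE (neq_lift _ _)) (mem_imset _ _ liftI).
rewrite (reindex_onto (fun J : {set 'I_q} => lift ord0 @: J)
  (fun I => lift ord0 @^-1: I)) /= => [|I I0].
  by apply: eq_bigl => J; rewrite ord0N preK eqxx.
rewrite imK; apply/setP => i; rewrite !inE.
by case: eqP => // ->; rewrite (negbTE I0).
Qed.

Lemma sum_set_card (V : nmodType) q (g : nat -> V) :
  \sum_(J : {set 'I_q}) g #|J| = \sum_(k < q.+1) g k *+ 'C(q, k).
Proof.
have cardJ (J : {set 'I_q}) : (#|J| < q.+1)%N.
  by rewrite ltnS -[q in leqRHS]card_ord max_card.
rewrite (partition_big (fun J => Ordinal (cardJ J)) xpredT) //=.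
apply: eq_bigr => k _.
have -> : 'C(q, k) = #|[set J : {set 'I_q} | #|J| == k]|.
  by rewrite card_draws card_ord.
rewrite -sumr_const.
by apply: eq_big => [J|J /eqP <-] //; rewrite inE -val_eqE.
Qed.

(** By Pascal's rule two neighbouring entries of row [q] add up to an inner entry of row [q.+1],
    which the prime [q.+1] divides; so the signs alternate, starting from 1. *)
Lemma natr_bin_pred_pchar (R : nzRingType) q k :
  q.+1 \in [pchar R] -> (k <= q)%N -> 'C(q, k)%:R = (-1) ^+ k :> R.
Proof.
move=> charR; elim: k => [_|k IHk ltkq]; first by rewrite bin0.
have: 'C(q.+1, k.+1)%:R = 0 :> R.
  apply/eqP; rewrite -(dvdn_pcharf charR) prime_dvd_bin ?(pcharf_prime charR) //.
by rewrite binS natrD IHk 1?ltnW // exprS mulN1r => /eqP; rewrite addr_eq0 => /eqP.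
Qed.

Section GAPNKernel.

Variables (p : nat) (F : fieldExtType 'F_p) (f : F -> F).
Hypothesis p_pr : prime p.

Lemma pchar_ext_Fp : p \in [pchar F].
Proof. by rewrite pchar_lalg pchar_Fp. Qed.

Lemma mdiff_const m (x y : F) : m \in [pchar F] ->
  mdiff f (fun i : 'I_m => if i == 0%N :> nat then x else y) =
  \sum_(k < m) (f (x + y *+ k) - f (y *+ k)).
Proof.
case: m => [/pcharf_prime //|q] charF; rewrite /mdiff big_set_ordS.
under eq_bigr => J _.
  have lift_sum : \sum_(k in lift ord0 @: J) (if k == 0%N :> nat then x else y)
      = y *+ #|J|.
    rewrite big_imset /=; last by move=> i j _ _; apply: lift_inj.
    by rewrite sumr_const.
  have ord0N : ord0 \notin lift ord0 @: J.
    by apply/imsetP => -[j _ /eqP]; rewrite (negbTE (neq_lift _ _)).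
  have cardJ : (#|J| <= q)%N by rewrite -[q in leqRHS]card_ord max_card.
  rewrite big_setU1 //= lift_sum cardsU1 ord0N card_imset; last exact: lift_inj.
  (* Dropping [ord0] from a subset lowers its cardinal by one and flips the sign. *)
  rewrite add1n subSS subSn // exprS mulN1r mulNr -mulrBr.
  over.
rewrite (sum_set_card F q
  (fun k => (-1) ^+ (q - k) * (f (x + y *+ k) - f (y *+ k)))).
apply: eq_bigr => k _; have lekq : (k <= q)%N by rewrite -ltnS.
(* Reading the binomial congruence at [k = q] covers characteristic 2 as well, where [q = 1]. *)
have signq : (-1) ^+ q = 1 :> F.
  by rewrite -(natr_bin_pred_pchar F q q charF (leqnn q)) binn.
rewrite -mulr_natl mulrA (natr_bin_pred_pchar F q k charF lekq).
by rewrite -exprD subnKC // signq mul1r.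
Qed.

Lemma Dtilde_nat a x : Dtilde f a x = \sum_(k < p) f (x + a *+ k).
Proof.
rewrite /Dtilde -(big_mkord xpredT (fun k => f (x + a *+ k))).
(* The index bound built into ['F_p] equals [p] because [p] is prime. *)
rewrite -[X in index_iota _ X](Fp_cast p_pr) big_mkord.
by apply: eq_bigr => j _; rewrite -[in LHS](natr_Zp j) scaler_nat.
Qed.

Lemma Btilde_Dtilde x a : Btilde f x a = Dtilde f a x - Dtilde f a 0.
Proof.
rewrite !Dtilde_nat -sumrB /Btilde mdiff_const ?pchar_ext_Fp //.
by apply: eq_bigr => k _; rewrite add0r.
Qed.

(** Translation by [t] permutes the summation index in ['F_p]. *)
Lemma Dtilde_line t a : Dtilde f a (t *: a) = Dtilde f a 0.
Proof.
rewrite /Dtilde (reindex_inj (addrI (- t))) /=.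
by apply: eq_bigr => j _; rewrite -scalerDl add0r addrA subrr add0r.
Qed.

Lemma card_line a : a != 0 ->
  #|[set x : finvect_type F | (x : F) \in <[a]>%VS]| = p.
Proof.
move=> a0; rewrite cardsE (@card_vspace _ (finvect_type F) _ <[a]>%VS).
by rewrite dim_vline a0 card_Fp.
Qed.

Lemma Btilde_eq0 x a : GAPN f -> a != 0 ->
  (Btilde f x a == 0) = (x \in <[a]>%VS).
Proof.
move=> fG a0; rewrite Btilde_Dtilde subr_eq0.
pose L := [set z : finvect_type F | (z : F) \in <[a]>%VS].
pose K := [set z : finvect_type F | Dtilde f a z == Dtilde f a 0].
suff /setP/(_ x) : L = K by rewrite !inE.
(* [K] is a fibre of [Dtilde f a], so GAPN bounds its size by [p], the size of [L]. *)
apply/eqP; rewrite eqEcard card_line // [(_ <= p)%N]fG // andbT.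
by apply/subsetP => z; rewrite !inE => /vlineP[t ->]; rewrite Dtilde_line.
Qed.

End GAPNKernel.

Section Graphs.

Variables (p : nat) (F : fieldExtType 'F_p) (B : F -> F -> F).
Implicit Types (a b x y : F).

Lemma mem_graph_set a x y :
  (((x, y) : finvect_type (F * F)%type) \in graph_set B a) = (y == B x a).
Proof. by apply/imsetP/eqP => [[z _ [-> ->]] | ->] //; exists x. Qed.

Lemma graph_set_subspace a :
  linear (B^~ a) -> subspace_of_dim (\dim {:F}) (graph_set B a).
Proof.
move=> Blin; pose h x : (F * F)%type := (x, B x a).
have hlin : linear h.
  by move=> t x y; apply: (f_equal2 pair) => //; apply: Blin.
pose H : {linear F -> (F * F)%type} := HB.pack h
  (GRing.isLinear.Build 'F_p F (F * F)%type *:%R h hlin).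
exists (limg (linfun H)); split.
  apply/setP => -[x y]; rewrite mem_graph_set inE.
  apply/eqP/memv_imgP => [-> | [z _]].
    by exists x; rewrite ?memvf // lfunE.
  by rewrite lfunE => -[-> ->].
(* The map [h] is injective, since its first coordinate is the identity. *)
apply: limg_dim_eq; apply/eqP; rewrite -subv0; apply/subvP => x.
by rewrite memv_cap memv_ker lfunE memv0 => /andP[_ /eqP[->]].
Qed.

Hypothesis p_pr : prime p.
Hypothesis Bbil : bilinear_for *:%R *:%R B.
Variable nu : F -> F.
Hypotheses (nu_inj : injective nu) (nu0 : nu 0 = 0).
(** The form in which the GAPN property enters this section; with bilinearity it decides where two
    graphs meet. *)
Hypothesis ker_B : forall c x, c != 0 -> (B x c == 0) = (x \in <[nu c]>%VS).

Let Bl a : linear (B^~ a). Proof. exact: Bbil.1. Qed.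
Let Br x : linear (B x). Proof. exact: Bbil.2. Qed.

Let Br0 x : B x 0 = 0.
Proof. by have := Br x (-1) 0 0; rewrite !scaleN1r oppr0 !addr0 addNr. Qed.

Let Bl0 a : B 0 a = 0.
Proof. by have := Bl a (-1) 0 0; rewrite !scaleN1r oppr0 !addr0 addNr. Qed.

Let BrB x a b : B x (a - b) = B x a - B x b.
Proof. by have := Br x (-1) b a; rewrite !scaleN1r ![- _ + _]addrC. Qed.

Let BrZ x t a : B x (t *: a) = t *: B x a.
Proof. by have := Br x t a 0; rewrite Br0 !addr0. Qed.

Let BlZ a t x : B (t *: x) a = t *: B x a.
Proof. by have := Bl a t x 0; rewrite Bl0 !addr0. Qed.

Lemma eq_graph_line x a b :
  a != b -> (B x a == B x b) = (x \in <[nu (a - b)]>%VS).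
Proof. by move=> ab; rewrite -subr_eq0 -BrB ker_B ?subr_eq0. Qed.

Lemma graph_setI_subspace a b : a != b ->
  subspace_of_dim 1 (graph_set B a :&: graph_set B b).
Proof.
move=> ab; set w := nu (a - b).
have w0 : w != 0 by rewrite -nu0 (inj_eq nu_inj) subr_eq0.
(* The graphs agree exactly above the line of [w], and [w] is nonzero because [nu] is injective and
   fixes 0. *)
exists <[(w, B w a)]>%VS; split; last first.
  by rewrite dim_vline xpair_eqE negb_and w0.
apply/setP => -[x y]; rewrite in_setI !mem_graph_set inE.
apply/andP/vlineP => [[/eqP-> ] | [t [-> ->]]].
  rewrite eq_graph_line // => /vlineP[t ->]; exists t.
  by rewrite BlZ.
by rewrite -BlZ eqxx eq_graph_line // memvZ ?memv_line.
Qed.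

(* For [x != 0] the kernel of [B x] has at most [p] elements, since [nu] embeds
   it in the line spanned by [x]; hence it is spanned by any [y != 0] in it. *)
Lemma ker_Bl_line x y z : x != 0 -> y != 0 ->
  B x y = 0 -> B x z = 0 -> z \in <[y]>%VS.
Proof.
move=> x0 y0 Bxy Bxz.
pose L := [set u : finvect_type F | (u : F) \in <[y]>%VS].
pose K := [set u : finvect_type F | B x u == 0].
suff /setP/(_ z) : L = K by rewrite !inE Bxz eqxx.
apply/eqP; rewrite eqEcard; apply/andP; split.
  by apply/subsetP => u; rewrite !inE => /vlineP[t ->]; rewrite BrZ Bxy scaler0.
rewrite card_line //; apply: leq_trans (eq_leq (card_line p F p_pr x x0)).
rewrite -(card_imset K (nu_inj : injective (nu : finvect_type F -> finvect_type F))).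
apply/subset_leq_card/subsetP => _ /imsetP[u + ->]; rewrite !inE.
have [-> _|u0] := eqVneq u 0; first by rewrite nu0 mem0v.
rewrite ker_B // => /vlineP[t xE].
(* As [x] is nonzero, [t] is invertible, and [nu u] lies on the line of [x] in turn. *)
have t0 : t != 0 by apply: contraNneq x0 => t0; rewrite xE t0 scale0r.
by rewrite xE -[nu u in X in X \in _](scalerK t0) memvZ ?memv_line.
Qed.

Lemma graph_setI3 (a b c : finvect_type F) : a != b -> b != c ->
  ~ on_same_line [set a; b; c] ->
  graph_set B a :&: graph_set B b :&: graph_set B c = [set 0].
Proof.
move=> ab bc ncol; apply/setP => -[x y].
rewrite !in_setI !mem_graph_set in_set1 xpair_eqE.
apply/andP/andP => [[/andP[/eqP-> xab] xbc] | [/eqP-> /eqP->]]; last first.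
  by rewrite !Bl0 eqxx.
have [->|x0] := eqVneq x 0; first by rewrite Bl0.
(* On this line [a], [b], [c] have parameters 1, 0 and [t], where [c - b = t *: (a - b)]. *)
case: ncol; exists b, (a - b); split; first by rewrite subr_eq0.
have ca : c - b \in <[a - b]>%VS.
  apply: (ker_Bl_line x); rewrite ?subr_eq0 // BrB; apply/eqP; rewrite subr_eq0 //.
  by rewrite -(eqP xab) eq_sym.
have [t cE] := vlineP _ _ ca.
apply/subsetP => u; rewrite !inE => /orP[/orP[]|] /eqP->; apply/imsetP.
- by exists 1; rewrite // scale1r addrC subrK.
- by exists 0; rewrite // scale0r addr0.
- by exists t; rewrite // -cE addrC subrK.
Qed.

End Graphs.

Theorem theorem5p5 (p n : nat) (F : fieldExtType 'F_p)
    (f : F -> F) (mu : F -> 'End(F)) (nu : F -> F)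
    (M : {set finvect_type F}) :
  prime p -> (2 <= n)%N -> #|finvect_type F| = (p ^ n)%N ->
  GAPN f -> alg_degree f p ->
  (forall a : F, a != 0 -> bijective (mu a)) ->
  bijective nu -> nu 0 = 0 ->
  bilinear_for *:%R *:%R (Btilde_twist f mu nu) ->
  (forall a b c : finvect_type F, a \in M -> b \in M -> c \in M ->
     a != b -> b != c -> a != c -> ~ on_same_line [set a; b; c]) ->
  dual_arc n.-1 [set graph_set (Btilde_twist f mu nu) a | a : finvect_type F in M].
Proof.
move=> p_pr n_ge2 cardF fG _ mu_bij nu_bij nu0 Bbil noline.
have nu_inj := bij_inj nu_bij.
(* Each [mu c] is linear and injective, so the twist preserves the kernel. *)
have ker_B c x : c != 0 ->
    (Btilde_twist f mu nu x c == 0) = (x \in <[nu c]>%VS).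
  move=> c0; rewrite /Btilde_twist (negbTE c0).
  rewrite -(Btilde_eq0 p F f) //; last by rewrite -nu0 (inj_eq nu_inj).
  apply/eqP/eqP => [|->]; last exact: linear0.
  by rewrite -[RHS](linear0 (mu c)) => /(bij_inj (mu_bij c c0)).
have dimF : \dim {:F} = n.
  have := @card_vspace _ (finvect_type F) _ {:F}%VS.
  rewrite card_vspacef cardF card_Fp // => /eqP.
  by rewrite eqn_exp2l ?prime_gt1 // => /eqP.
set B := Btilde_twist f mu nu in Bbil ker_B *.
split.
- move=> _ /imsetP[a _ ->]; rewrite prednK 1?ltnW // -dimF.
  by apply: graph_set_subspace; apply: Bbil.1.
- move=> _ _ /imsetP[a _ ->] /imsetP[b _ ->] Xab.
  apply: (graph_setI_subspace p F B Bbil nu) => //.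
  (* Different graphs come from different indices. *)
  by apply: contraNneq Xab => ->.
- move=> _ _ _ /imsetP[a aM ->] /imsetP[b bM ->] /imsetP[c cM ->] Xab Xbc Xac.
  have [ab bc ac] : [/\ a != b, b != c & a != c].
    by split; [apply: contraNneq Xab | apply: contraNneq Xbc
              | apply: contraNneq Xac] => ->.
  by apply: (graph_setI3 p F B p_pr Bbil nu) => //; apply: noline.
Qed.
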